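(* Let $n$ be a positive integer, $N=2n$, and let $d_1,\ldots,d_n\in (\mathbb{Z}/N)^*$. Then there exist $s_1,\ldots,s_n\in \{1,-1\}$ such that $$s_1d_1+\cdots+s_nd_n\equiv n \pmod{2n}.$$
   Context: $(\mathbb{Z}/N)^*$ denotes the group of units of $\mathbb{Z}/N$, i.e., residues coprime to $N$. *)

(* Defs.v *)
From mathcomp Require Import all_boot all_order all_algebra.

Set Implicit Arguments.
Unset Strict Implicit.
Unset Printing Implicit Defensive.

(* Main.v *)
Require Import Defs.
From mathcomp Require Import all_boot all_order all_algebra.
Import GRing.Theory.
Local Open Scope ring_scope.

(** Write the sign vector as -1 on a set K and 1 elsewhere: the signed sum is
    the sum of all d_i minus the sum over K of 2 d_i.  Every unit mod 2n is odd,
    so (sum of the d_i) - n is the sum of the d_i - 1 and hence even, and it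
    suffices that the subset sums of the 2 d_i exhaust the n even residues.
    Each 2 d_i generates the group of even residues, so adjoining a term either
    enlarges the set of subset sums or finds it stable under translation by a
    generator, that is, already full; n terms are enough. *)

Definition subset_sums (V : finZmodType) (I : finType) (g : I -> V)
    (J : {set I}) : {set V} :=
  [set \sum_(i in K) g i | K : {set I} in powerset J].

Lemma subset_sumsP (V : finZmodType) (I : finType) (g : I -> V)
    (J : {set I}) (x : V) :
  reflect (exists2 K : {set I}, K \subset J & x = \sum_(i in K) g i)
          (x \in subset_sums V I g J).
Proof.
apply: (iffP imsetP) => [[K KJ ->]|[K KJ ->]]; exists K => //.
  by rewrite -powersetE.
by rewrite powersetE.
Qed.

Lemma subset_sums0 (V : finZmodType) (I : finType) (g : I -> V)
    (J : {set I}) :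
  0 \in subset_sums V I g J.
Proof. by apply/subset_sumsP; exists set0; rewrite ?sub0set ?big_set0. Qed.

Lemma subset_sumsS (V : finZmodType) (I : finType) (g : I -> V)
    (J J' : {set I}) :
  J \subset J' -> subset_sums V I g J \subset subset_sums V I g J'.
Proof.
move=> sJ; apply/subsetP => x /subset_sumsP[K KJ ->].
by apply/subset_sumsP; exists K => //; apply: subset_trans sJ.
Qed.

Lemma subset_sumsD1 (V : finZmodType) (I : finType) (g : I -> V)
    (J : {set I}) (j : I) (x : V) :
  j \in J -> x \in subset_sums V I g (J :\ j) ->
  x + g j \in subset_sums V I g J.
Proof.
move=> jJ /subset_sumsP[K]; rewrite subsetD1 => /andP[KJ jK] ->.
apply/subset_sumsP; exists (j |: K); first by rewrite subUset sub1set jJ.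
by rewrite big_setU1 //= addrC.
Qed.

(** Induction on [#|J|], removing one [j]. If the sums over [J :\ j] are already all those over [J],
    this set contains 0 and is stable under adding [g j], so it contains every multiple of [g j],
    hence [T]. Otherwise [j] brings at least one new sum. *)
Lemma card_subset_sums (V : finZmodType) (I : finType) (g : I -> V)
    (T : {set V}) (J : {set I}) :
  (forall i x, x \in T -> exists m, x = g i *+ m) ->
  T \subset subset_sums V I g J \/ (#|J| < #|subset_sums V I g J|)%N.
Proof.
move=> gT; have [k] := ubnP #|J|; elim: k J => // k IHk J.
have [-> _|[j jJ]] := set_0Vmem J.
  by right; rewrite cards0 card_gt0; apply/set0Pn; exists 0; apply: subset_sums0.
rewrite (cardsD1 j J) jJ ltnS => /IHk IH.
have sJ := subset_sumsS V I g _ _ (subD1set J j).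
case: IH => [TJ|ltJ]; first by left; apply: subset_trans sJ.
have [eqJ|neqJ] := eqVneq (subset_sums V I g (J :\ j)) (subset_sums V I g J).
  left; apply/subsetP => x /(gT j)[m ->].
  elim: m => [|m IHm]; first by rewrite mulr0n subset_sums0.
  by rewrite mulrSr subset_sumsD1 // eqJ.
right; apply: leq_ltn_trans ltJ _.
by apply: proper_card; rewrite properEneq neqJ.
Qed.

(** Doubling modulo [2 * n] depends only on the argument modulo [n], so [n] representatives
    suffice. *)
Lemma card_even_Zp (n : nat) :
  (0 < n)%N -> (#|[set x *+ 2 | x : 'Z_(2 * n)]| <= n)%N.
Proof.
move=> n0; have n2 : (1 < 2 * n)%N by exact: leq_pmulr.
set T := imset _ _.
suff /subset_leq_card : T \subset [set (2 * i)%:R | i : 'I_n].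
  move/leq_trans; apply.
  by apply: leq_trans (leq_imset_card _ _) _; rewrite card_ord.
apply/subsetP => _ /imsetP[x _ ->]; apply/imsetP.
exists (Ordinal (ltn_pmod x n0)) => //=.
by rewrite muln_modr Zp_nat_mod // natrM natr_Zp mulr_natl.
Qed.

Lemma unit_Zp_odd (n : nat) (u : 'Z_(2 * n)) :
  (0 < n)%N -> u \is a GRing.unit -> odd u.
Proof.
move=> n0; have n2 : (1 < 2 * n)%N by exact: leq_pmulr.
by rewrite -{1}(natr_Zp u) unitZpE // coprimeMl coprime2n => /andP[].
Qed.

Theorem theorem2p2 (n : nat) (n_gt0 : (0 < n)%N)
    (d : 'I_n -> {unit 'Z_(2 * n)}) :
  exists s : 'I_n -> int,
    (forall i, s i = 1 \/ s i = -1) /\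
    \sum_(i < n) (s i)%:~R * val (d i) = n%:R :> 'Z_(2 * n).
Proof.
pose T := [set x *+ 2 | x : 'Z_(2 * n)].
pose g i := val (d i) *+ 2.
have gT i x : x \in T -> exists m, x = g i *+ m.
  (* The multiplier is the natural representative of y / d_i, since (y / d_i) * 2 d_i = 2 y. *)
  case/imsetP=> y _ ->; exists (val ((val (d i))^-1 * y)).
  rewrite /g mulrnAC -[_ *+ val _]mulr_natr natr_Zp mulrA mulrV ?mul1r //.
  exact: (valP (d i)).
(* The strict alternative would give more than [n] subset sums, all of them doubles, against
   [card_even_Zp]. *)
have [sumsT|] := card_subset_sums 'Z_(2 * n) 'I_n g T setT gT; last first.
  rewrite cardsT card_ord ltnNge => /negP[].
  apply: leq_trans (card_even_Zp n n_gt0); apply: subset_leq_card.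
  apply/subsetP => _ /subset_sumsP[K _ ->].
  by rewrite sumrMnl; apply: imset_f.
have : \sum_i val (d i) - n%:R \in T.
  have odd_d i : val (d i) = 1 + (val (d i))./2%:R *+ 2.
    have := odd_double_half (val (d i)).
    rewrite unit_Zp_odd //; last exact: (valP (d i)).
    move=> /(congr1 (fun m => m%:R : 'Z_(2 * n))).
    by rewrite natr_Zp natrD -muln2 natrM mulr_natr.
  rewrite (eq_bigr _ (fun i _ => odd_d i)) big_split /= sumr_const card_ord.
  by rewrite addrAC subrr add0r sumrMnl; apply: imset_f.
move=> /(subsetP sumsT)/subset_sumsP[K _ sumK].
exists (fun i => if i \in K then -1 else 1); split=> [i|].
  by case: ifP; [right|left].
(* With S the sum of all d_i, write n = S - (S - n), where S - n is the sum of 2 d_i over [K];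
   termwise, d_i - 2 d_i = -d_i on [K]. *)
rewrite -[RHS](subKr (\sum_i val (d i))) sumK.
rewrite [X in _ - X]big_mkcond -sumrB; apply: eq_bigr => i _.
case: (i \in K); last by rewrite mul1r subr0.
by rewrite mulrN1z mulN1r /g mulr2n opprD addNKr.
Qed.
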